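(* Let $|\psi_{id}\rangle\in\mathbb{C}^d$ be a unit vector, let $\rho$ be a density matrix on $\mathbb{C}^d$ with a non-degenerate largest eigenvalue and corresponding unit eigenvector $|\psi\rangle$, and let $c=1-|\langle\psi_{id}|\psi\rangle|^2$. Let $O$ be a Hermitian $d\times d$ matrix such that $|\psi_{id}\rangle$ is an eigenvector of $O$, i.e. $O|\psi_{id}\rangle=E|\psi_{id}\rangle$ for some real $E$. Then $$\bigl|\langle\psi_{id}|O|\psi_{id}\rangle-\langle\psi|O|\psi\rangle\bigr|\le 2c\,\lVert O\rVert_\infty .$$
   Context: A density matrix is a positive semidefinite complex matrix of trace one. $\lVert O\rVert_\infty$ is the operator norm, i.e. the largest absolute value of an eigenvalue of $O$. *)

(* Defs.v *)
From mathcomp Require Import all_boot all_order all_algebra.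
From mathcomp Require Import complex.
From mathcomp Require Import boolp classical_sets reals.

Set Implicit Arguments.
Unset Strict Implicit.
Unset Printing Implicit Defensive.

Import Order.TTheory GRing.Theory Num.Theory.
Local Open Scope ring_scope.
Local Open Scope complex_scope.
Local Open Scope sesquilinear_scope.

(* Kets are column vectors, and the bra of [u] is its conjugate transpose
   [u ^t*], so [braket] is conjugate-linear in its first argument. *)
Definition braket (R : realType) (d : nat) (u v : 'cV[R[i]]_d) : R[i] :=
  (u ^t* *m v) 0 0.

Definition expval (R : realType) (d : nat) (A : 'M[R[i]]_d)
    (u : 'cV[R[i]]_d) : R[i] :=
  braket u (A *m u).

(* In the order of [R[i]], [0 <= z] means that [z] is real and nonnegative. *)
Definition psdmx (R : realType) (d : nat) (A : 'M[R[i]]_d) : Prop :=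
  A \is hermsymmx /\ forall u : 'cV[R[i]]_d, 0 <= expval A u.

Definition density_matrix (R : realType) (d : nat) (A : 'M[R[i]]_d) : Prop :=
  psdmx A /\ \tr A = 1.

(* [eigenvalue] and [eigenspace] refer to row vectors; a square matrix and its
   transpose have the same eigenvalues and eigenspaces of the same dimensions,
   so this agrees with the convention for column vectors. *)
Definition nondegenerate_largest_eigenvalue (R : realType) (d : nat)
    (A : 'M[R[i]]_d) (l : R[i]) : Prop :=
  [/\ eigenvalue A l,
      \rank (eigenspace A l) = 1%N
    & forall m : R[i], eigenvalue A m -> m <= l].

(* The operator norm of a Hermitian matrix, as the largest absolute value of an
   eigenvalue. For [0 < d] the set below is nonempty and finite, so that the
   supremum is a maximum; see [opnorm_max]. *)
Definition opnorm (R : realType) (d : nat) (A : 'M[R[i]]_d) : R :=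
  sup [set r : R | exists2 l : R[i], eigenvalue A l & `|l| = r%:C]%classic.

Lemma opnorm_max (R : realType) (d : nat) (A : 'M[R[i]]_d) : (0 < d)%N ->
  (exists2 l : R[i], eigenvalue A l & `|l| = (opnorm A)%:C) /\
  (forall l : R[i], eigenvalue A l -> `|l| <= (opnorm A)%:C).
Proof.
move=> d_gt0; rewrite /opnorm; set S := [set r : R | _]%classic.
have absE (l : R[i]) : `|l| = (complex.Re `|l|)%:C by rewrite normc_def.
have [rs rsE] := closed_field_poly_normal (char_poly A).
have in_rs l : eigenvalue A l -> l \in rs.
  rewrite eigenvalue_root_char rsE (monicP (char_poly_monic A)) scale1r.
  by rewrite root_prod_XsubC.
have [l0 l0A] := eigenvalue_closed A d_gt0.
pose f (l : R[i]) := complex.Re `|l|.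
pose T := [seq l <- rs | eigenvalue A l].
have TA l : (l \in T) = eigenvalue A l.
  by rewrite mem_filter; apply: andb_idr => /in_rs.
have [m mA m_max] : exists2 m, eigenvalue A m &
    forall l, eigenvalue A l -> f l <= f m.
  have : exists2 m, m \in T & forall l, l \in T -> f l <= f m.
    have : l0 \in T by rewrite TA.
    elim: {TA}T l0 {l0A} => // a s IH _ _; case: s IH => [_|b s IH].
      by exists a; rewrite ?mem_head // => l; rewrite inE => /eqP->.
    have [m ms m_max] := IH b (mem_head b s).
    have [le_am|/ltW le_ma] := leP (f a) (f m).
      by exists m => [|l]; rewrite inE ?ms ?orbT // => /predU1P[->|/m_max].
    exists a => [|l]; rewrite inE ?eqxx // => /predU1P[->//|/m_max le_lm].
    exact: le_trans le_lm le_ma.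
  by case=> m mT mM; exists m; rewrite -?TA // => l; rewrite -TA; exact: mM.
have mS : S (f m) by exists m => //; rewrite absE.
have Sub : ubound S (f m).
  by move=> r [l lA]; rewrite absE => -[<-]; exact: m_max.
have -> : sup S = f m.
  apply/le_anti/andP; split; first by apply: ge_sup => //; exists (f m).
  by apply: ub_le_sup => //; exists (f m).
split; first by exists m => //; rewrite absE.
by move=> l lA; rewrite absE lecR; exact: m_max.
Qed.

(* Main.v *)
(** Write psi = a psi_id + phi with a = <psi_id|psi> and phi orthogonal to
    psi_id, so that <phi|phi> = 1 - |a|^2 = c.  Since psi_id is an eigenvector
    of the Hermitian matrix O, O phi is orthogonal to psi_id as well; the cross
    terms of <psi|O|psi> vanish, and the error is c E - <phi|O|phi>.  Each of
    the two terms is at most c times the operator norm. *)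

Require Import Defs.
From mathcomp Require Import all_boot all_order all_algebra.
From mathcomp Require Import complex.
From mathcomp Require Import boolp classical_sets reals.
From mathcomp Require Import ring.

Import Order.TTheory GRing.Theory Num.Theory.
Local Open Scope ring_scope.
Local Open Scope complex_scope.
Local Open Scope sesquilinear_scope.

Lemma braketDr (R : realType) (d : nat) (u v w : 'cV[R[i]]_d) :
  braket u (v + w) = braket u v + braket u w.
Proof. by rewrite /braket mulmxDr mxE. Qed.

Lemma braketZr (R : realType) (d : nat) (a : R[i]) (u v : 'cV[R[i]]_d) :
  braket u (a *: v) = a * braket u v.
Proof. by rewrite /braket -scalemxAr mxE. Qed.

Lemma braketC (R : realType) (d : nat) (u v : 'cV[R[i]]_d) :
  braket v u = Num.conj (braket u v).
Proof.
rewrite /braket !mxE rmorph_sum; apply: eq_bigr => j _.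
by rewrite rmorphM !mxE /= conjCK mulrC.
Qed.

Lemma braketDl (R : realType) (d : nat) (u v w : 'cV[R[i]]_d) :
  braket (u + v) w = braket u w + braket v w.
Proof. by rewrite ![braket _ w]braketC braketDr rmorphD. Qed.

Lemma braketZl (R : realType) (d : nat) (a : R[i]) (u v : 'cV[R[i]]_d) :
  braket (a *: u) v = Num.conj a * braket u v.
Proof. by rewrite ![braket _ v]braketC braketZr rmorphM. Qed.

Lemma braket_mulmxl (R : realType) (m n : nat) (A : 'M[R[i]]_(m, n))
    (u : 'cV[R[i]]_n) (v : 'cV[R[i]]_m) :
  braket (A *m u) v = braket u (A ^t* *m v).
Proof. by rewrite /braket trmx_mul map_mxM mulmxA. Qed.

Lemma braket_herm (R : realType) (d : nat) (A : 'M[R[i]]_d)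
    (u v : 'cV[R[i]]_d) :
  A \is hermsymmx -> braket (A *m u) v = braket u (A *m v).
Proof.
by move=> /is_hermitianmxP; rewrite expr0 scale1r braket_mulmxl => <-.
Qed.

Lemma braket_sqnorm (R : realType) (d : nat) (u : 'cV[R[i]]_d) :
  braket u u = \sum_j `|u j 0| ^+ 2.
Proof.
by rewrite /braket mxE; apply: eq_bigr => j _; rewrite !mxE mulrC normCK.
Qed.

Lemma braket_ge0 (R : realType) (d : nat) (u : 'cV[R[i]]_d) :
  0 <= braket u u.
Proof. by rewrite braket_sqnorm sumr_ge0 // => j _; rewrite exprn_ge0. Qed.

Lemma braket0 (R : realType) (u v : 'cV[R[i]]_0) : braket u v = 0.
Proof. by rewrite /braket mxE big_ord0. Qed.

(** The diagonalisation reads [P *m A = D *m P] with [P] invertible, so row [j] of [P] is a left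
    eigenvector; it is nonzero, since otherwise [P] would kill the basis row [delta_mx 0 j]. *)
Lemma spectral_diag_eigenvalue (C : numClosedFieldType) (n : nat)
    (A : 'M[C]_n) (j : 'I_n) :
  A \is normalmx -> eigenvalue A (spectral_diag A 0 j).
Proof.
move=> /orthomx_spectralP defA; set P := spectralmx A.
have Pu : P \in unitmx by exact: spectral_unit.
have PA : P *m A = diag_mx (spectral_diag A) *m P.
  by rewrite [in LHS]defA -mulmxA mulKVmx.
apply/eigenvalueP; exists (row j P).
  by rewrite -row_mul PA row_mul row_diag_mx -scalemxAl -rowE.
apply/eqP => Pj0; move: Pu; rewrite -row_free_unit => /row_free_inj Pinj.
have : delta_mx 0 j = 0 :> 'rV[C]_n by apply: Pinj; rewrite -rowE Pj0 mul0mx.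
by move/rowP/(_ j); rewrite !mxE !eqxx => /eqP; rewrite oner_eq0.
Qed.

(** In an orthonormal eigenbasis the expectation value is a sum of eigenvalues weighted by squared
    moduli of coordinates, and these weights add up to [braket u u]. *)
Lemma normr_expval_le (R : realType) (d : nat) (A : 'M[R[i]]_d)
    (u : 'cV[R[i]]_d) :
  A \is hermsymmx -> `|expval A u| <= (opnorm A)%:C * braket u u.
Proof.
(* Dimension 0 is split off because [opnorm_max] assumes [0 < d]. *)
case: d A u => [|d] A u; first by rewrite /expval !braket0 normr0 mulr0.
move=> /hermitian_normalmx An.
have [_ le_opnorm] := opnorm_max A (ltn0Sn d).
set P := spectralmx A; set s := spectral_diag A.
have Pu : P \is unitarymx by exact: spectral_unitarymx.
have defA : A = P ^t* *m diag_mx s *m P.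
  by rewrite -invmx_unitary //; exact/orthomx_spectralP.
pose w := P *m u.
have -> : braket u u = braket w w.
  by rewrite braket_mulmxl mulmxA -[P^t*]invmx_unitary // mulVmx ?mul1mx ?unitarymx_unit.
have -> : expval A u = \sum_j s 0 j * `|w j 0| ^+ 2.
  (* The left factor [P ^t*] moves into the bra, where it becomes [P], so that [w] stands on both
     sides of the diagonal matrix. *)
  rewrite /expval {1}defA -!mulmxA -/w -{1}[P]trmxCK.
  rewrite -braket_mulmxl trmxCK -/w /braket mxE; apply: eq_bigr => j _.
  by rewrite mul_diag_mx; move: w => w; rewrite !mxE normCK; ring.
rewrite braket_sqnorm mulr_sumr (le_trans (ler_norm_sum _ _ _)) //.
apply: ler_sum => j _; rewrite normrM normrX normr_id.
by rewrite ler_wpM2r ?exprn_ge0 // le_opnorm // spectral_diag_eigenvalue.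
Qed.

Theorem mainTheorem5 (R : realType) (d : nat)
    (psi_id : 'cV[R[i]]_d) (psi_id_unit : braket psi_id psi_id = 1)
    (rho : 'M[R[i]]_d) (rho_density : density_matrix rho)
    (lambda : R[i])
    (lambda_largest : nondegenerate_largest_eigenvalue rho lambda)
    (psi : 'cV[R[i]]_d) (psi_unit : braket psi psi = 1)
    (psi_eigen : rho *m psi = lambda *: psi)
    (c : R[i]) (c_def : c = 1 - `|braket psi_id psi| ^+ 2)
    (O : 'M[R[i]]_d) (O_herm : O \is hermsymmx)
    (E : R) (psi_id_eigen : O *m psi_id = E%:C *: psi_id) :
  `|expval O psi_id - expval O psi| <= 2 * c * (opnorm O)%:C.
Proof.
move: c_def; set a := braket psi_id psi => c_def.
have [phi psiE id_phi] :
    exists2 phi, psi = a *: psi_id + phi & braket psi_id phi = 0.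
  exists (psi - a *: psi_id); first by rewrite addrC subrK.
  by rewrite braketDr -scaleNr braketZr psi_id_unit mulr1 subrr.
clearbody a.
have phi_id : braket phi psi_id = 0 by rewrite braketC id_phi rmorph0.
have id_Ophi : braket psi_id (O *m phi) = 0.
  by rewrite -braket_herm // psi_id_eigen braketZl id_phi mulr0.
have phi_phi : braket phi phi = c.
  (* The norm of [psi] expands to [|a|^2 + <phi|phi>], and this replaces the 1 in [1 - |a|^2]. *)
  move: psi_unit; rewrite c_def normCK psiE.
  rewrite !(braketDl, braketDr, braketZl, braketZr) id_phi phi_id psi_id_unit.
  by move=> <-; ring.
have id_O : expval O psi_id = E%:C.
  by rewrite /expval psi_id_eigen braketZr psi_id_unit mulr1.
have psi_O : expval O psi = (1 - c) * E%:C + expval O phi.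
  rewrite /expval psiE mulmxDr -scalemxAr.
  rewrite !(braketDl, braketDr, braketZl, braketZr) id_Ophi psi_id_eigen braketZr.
  by rewrite braketZr phi_id psi_id_unit c_def normCK; ring.
(* In the order of [R[i]] this also says that [c] is real, whence [c] is its own absolute value
   below. *)
have c_ge0 : 0 <= c by rewrite -phi_phi braket_ge0.
(* Reading [E] as an expectation value avoids turning the column eigenvector [psi_id] into a row
   one, as [eigenvalue] would require. *)
have le_E : `|E%:C| <= (opnorm O)%:C.
  by have := normr_expval_le _ _ _ psi_id O_herm; rewrite id_O psi_id_unit mulr1.
have -> : expval O psi_id - expval O psi = c * E%:C - expval O phi.
  by rewrite psi_O id_O; ring.
(* One summand for each term of the triangle inequality, with factors ordered to match the two
   bounds. *)
have -> : 2 * c * (opnorm O)%:C = c * (opnorm O)%:C + (opnorm O)%:C * c by ring.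
rewrite (le_trans (ler_normB _ _)) // lerD //.
  by rewrite normrM ger0_norm // ler_wpM2l.
by rewrite -phi_phi normr_expval_le.
Qed.
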